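(* Fix $i\in\{0,1\}$. Let $G$ be a connected graph with $n$ vertices and matching number $k$. If $2\le k<\lfloor n/2\rfloor$, then $\sigma_i(G)\le f_i(n,2k)$, with equality for every double-broom with $n$ vertices and diameter $2k$. If $k=\lfloor n/2\rfloor$, then $\sigma_i(G)\le\sigma_i(P_n)$, with equality if and only if $G=P_n$.
   Context: All graphs are finite, simple, undirected. For a connected graph $G$ and $u\in V(G)$, $\varepsilon_G(u)=\max_v d_G(u,v)$; $\sigma_0(G)=\frac1{|V(G)|}\sum_u\varepsilon_G(u)$, $\sigma_1(G)=\sum_u\varepsilon_G(u)^2$. The matching number is the maximum number of pairwise disjoint edges. $P_n$ is the path on $n$ vertices. A double-broom is a tree obtained from a path by attaching leaves to each of its two end vertices (possibly zero leaves). For integers $n>d\ge2$: $f_0(n,d)=d-\frac1n\lfloor d^2/4\rfloor$ and $f_1(n,d)=nd^2-\frac{5d}{12}(d^2-1)-\epsilon_d$, where $\epsilon_d=d/4$ if $d$ is even and $\epsilon_d=0$ if $d$ is odd (these are the values of $\sigma_0$, $\sigma_1$ on $n$-vertex double-brooms of diameter $d$). *)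

(* Defs.v *)
From mathcomp Require Import all_boot all_order all_algebra.
Set Implicit Arguments. Unset Strict Implicit. Unset Printing Implicit Defensive.
Import Order.TTheory GRing.Theory Num.Theory.

Section Graphs.
Variable T : finType.
Implicit Types (e : rel T) (u v : T).

Definition simple_graph e := symmetric e /\ irreflexive e.

Definition connected_graph e := 0 < #|T| /\ forall u v, connect e u v.

Definition walkb e u v (m : nat) : bool :=
  [exists p : m.-tuple T, path e u p && (last u p == v)].

(* distance: the least m (< #|T|) such that a walk of length m from u to v
   exists; for connected graphs this is the usual shortest-path distance *)
Definition dist e u v : nat := find (walkb e u v) (iota 0 #|T|).

Definition ecc e u : nat := \max_(v : T) dist e u v.

Definition diam e : nat := \max_(u : T) ecc e u.

Definition sigma0 e : rat := (\sum_(u : T) ecc e u)%:R / #|T|%:R.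
Definition sigma1 e : rat := (\sum_(u : T) (ecc e u) ^ 2)%:R.
Definition sigma (i : 'I_2) e : rat := if val i == 0 then sigma0 e else sigma1 e.

Definition is_matching e (M : {set T * T}) : bool :=
  [forall p in M, e p.1 p.2] &&
  [forall p in M, forall q in M,
     (p != q) ==> [disjoint [set p.1; p.2] & [set q.1; q.2]]].

Definition matching_number e : nat :=
  \max_(M : {set T * T} | is_matching e M) #|M|.

Definition consec (s : seq T) (x y : T) : bool :=
  ((x, y) \in zip s (behead s)) || ((y, x) \in zip s (behead s)).

(* double broom: a path (the spine s) with leaves attached to its two end
   vertices (head and last of s); side x says to which end a non-spine
   vertex x is attached. *)
Definition double_broom e : Prop :=
  exists (s : seq T) (side : T -> bool),
    [/\ s != [::], uniq s &
      forall x y, e x y =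
        [|| consec s x y,
            (x \notin s) && (y == (if side x then head y s else last y s))
          | (y \notin s) && (x == (if side y then head x s else last x s))]].

End Graphs.

Definition isomorphic (T T' : finType) (e : rel T) (e' : rel T') : Prop :=
  exists f : T -> T', bijective f /\ forall x y, e' (f x) (f y) = e x y.

Definition path_rel (n : nat) : rel 'I_n :=
  fun i j => (i.+1 == j :> nat) || (j.+1 == i :> nat).

Local Open Scope ring_scope.

Definition f0 (n d : nat) : rat := d%:R - (d ^ 2 %/ 4)%N%:R / n%:R.
Definition eps (d : nat) : rat := if odd d then 0 else d%:R / 4%:R.
Definition f1 (n d : nat) : rat :=
  (n * d ^ 2)%N%:R - (5 * d)%N%:R / 12%:R * (d%:R ^+ 2 - 1) - eps d.
Definition f (i : 'I_2) (n d : nat) : rat := if val i == 0%N then f0 n d else f1 n d.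

(* Main.v *)
(** Let [v_0, ..., v_L] be a longest path of [G].  A shortest path from [v_j] to
    its farthest vertex can be rerouted along this path up to some [v_m] and then
    off it for [r] steps, and maximality forces [r <= minn m (L - m)]; hence
    [ecc v_j <= maxn j (L - j)], while every eccentricity is at most [L].  The
    power sum of these bounds depends only on [n] and [L] and strictly increases
    with [L].  A path with [L] edges contains a matching with [(L + 1) / 2] edges,
    so [L <= 2 k], and in any case [L <= n - 1]; equality in the latter bound forces
    [ecc v_0 = n - 1], so that [G] is a path.  Double-brooms attain all the bounds. *)
Require Import Defs.
From mathcomp Require Import all_boot all_order all_algebra.
From mathcomp Require Import zify ring.
Set Implicit Arguments. Unset Strict Implicit. Unset Printing Implicit Defensive.
Import GRing.Theory Num.Theory.

(** * Distances and eccentricities *)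

Section Distance.
Variables (T : finType) (e : rel T).
Implicit Types (u v x y : T) (p : seq T).

Lemma walkbP u v m :
  reflect (exists p, [/\ path e u p, last u p = v & size p = m])
          (walkb e u v m).
Proof.
apply: (iffP existsP) => [[p /andP[ep /eqP lp]]|[p [ep lp sp]]].
  by exists p; split; rewrite ?size_tuple.
have sp' : size p == m by rewrite sp.
by exists (Tuple sp'); rewrite /= ep lp eqxx.
Qed.

(** [find] returns the length of the list when the search fails, so [#|T|] is both the default
    distance of unreachable pairs and a cap on all distances. This cap settles the unreachable cases
    below. *)
Lemma dist_le_card u v : dist e u v <= #|T|.
Proof. by rewrite -[X in _ <= X](size_iota 0) find_size. Qed.

Lemma dist_le_walk u p : path e u p -> dist e u (last u p) <= size p.
Proof.
move=> ep; case: (leqP #|T| (size p)) => [|lt_p].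
  by apply: leq_trans; apply: dist_le_card.
rewrite leqNgt; apply/negP => /(before_find 0).
rewrite nth_iota // add0n => no_walk.
by have/walkbP: exists p0, [/\ path e u p0, last u p0 = last u p & size p0 = size p];
  [exists p | rewrite no_walk].
Qed.

Lemma dist_walk u v : dist e u v < #|T| ->
  exists p, [/\ path e u p, last u p = v & size p = dist e u v].
Proof.
move=> lt_d; apply/walkbP.
have: has (walkb e u v) (iota 0 #|T|) by rewrite has_find size_iota.
by move/(nth_find 0); rewrite nth_iota.
Qed.

Lemma dist_triangle v u w : dist e u w <= dist e u v + dist e v w.
Proof.
have := dist_le_card u w.
case: (leqP #|T| (dist e u v)) => [|/dist_walk [p [ep lp <-]]]; first by lia.
case: (leqP #|T| (dist e v w)) => [|/dist_walk [q [eq_ lq <-]] _]; first by lia.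
rewrite -size_cat -lq -lp -last_cat; apply: dist_le_walk.
by rewrite cat_path ep lp.
Qed.

Lemma dist_edge u v : e u v -> dist e u v <= 1.
Proof. by move=> euv; apply: (@dist_le_walk u [:: v]); rewrite /= euv. Qed.

Lemma dist_refl u : dist e u u = 0.
Proof. by apply/eqP; rewrite -leqn0; apply: (@dist_le_walk u [::]). Qed.

Lemma dist_uniq_path u v : connect e u v ->
  exists p, [/\ path e u p, last u p = v, uniq (u :: p) & dist e u v <= size p].
Proof.
case/connectP=> p /shortenP[p' ep' Up' _] ->.
by exists p'; split=> //; apply: dist_le_walk.
Qed.

(** Along a walk [g] rises by at most one per edge. The second hypothesis settles pairs whose
    distance is the default [#|T|]. *)
Lemma dist_lipschitz (g : T -> nat) u v :
  (forall x y, e x y -> g y <= (g x).+1) ->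
  g v - g u <= #|T| -> g v - g u <= dist e u v.
Proof.
move=> gL le_g; case: (leqP #|T| (dist e u v)) => [|/dist_walk [p [ep <- <-]]].
  exact: leq_trans.
elim: p u ep {le_g} => [|y p IHp] u /=; first by rewrite subnn.
case/andP=> /gL guy /IHp; lia.
Qed.

Lemma dist_ecc u v : dist e u v <= ecc e u.
Proof. exact: (@leq_bigmax _ (fun v => dist e u v)). Qed.

Lemma ecc_leP u m : reflect (forall v, dist e u v <= m) (ecc e u <= m).
Proof. by apply: (iffP (bigmax_leqP _ _ _)) => H v //; apply: H. Qed.

Lemma ecc_attained u : exists v, ecc e u = dist e u v.
Proof.
case: (eq_bigmax (dist e u)) => [|v max_v]; first by apply/card_gt0P; exists u.
by exists v.
Qed.

Lemma ecc_diam u : ecc e u <= diam e.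
Proof. exact: (@leq_bigmax _ (ecc e)). Qed.

Hypothesis e_sym : symmetric e.

Lemma dist_sym u v : dist e u v = dist e v u.
Proof.
suff le_sym x y : dist e y x <= dist e x y by apply/eqP; rewrite eqn_leq !le_sym.
case: (leqP #|T| (dist e x y)) => [|/dist_walk [p [ep <- <-]]].
  exact/leq_trans/dist_le_card.
rewrite -(size_belast x) -size_rev.
have {2}-> : x = last (last x p) (rev (belast x p)).
  by case: p {ep} => //= z p; rewrite rev_cons last_rcons.
apply: dist_le_walk; rewrite rev_path; rewrite (eq_path (e' := e)) // => a b.
Qed.

(** With truncated subtraction the bound is |i - j|, the length of the stretch of [p] between the
    two positions. *)
Lemma dist_nth x0 p i j : sorted e p -> i < size p -> j < size p ->
  dist e (nth x0 p i) (nth x0 p j) <= (i - j) + (j - i).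
Proof.
move=> ep; wlog le_ij : i j / i <= j => [IH lti ltj|].
  by case/orP: (leq_total i j) => ?; last rewrite dist_sym addnC; apply: IH.
rewrite -(subnKC le_ij) => lti; elim: (j - i) => [|m IHm] lt_m.
  by rewrite addn0 dist_refl.
apply: leq_trans (dist_triangle (nth x0 p (i + m)) _ _) _.
have le_m : dist e (nth x0 p i) (nth x0 p (i + m)) <= i - (i + m) + (i + m - i).
  by apply: IHm; lia.
apply: leq_trans (leq_add le_m (dist_edge _)) _; last by lia.
rewrite addnS; apply: (sortedP x0 ep); lia.
Qed.
End Distance.

(* The [q]-th power sum of the eccentricities of a double-broom with [n] vertices
   and diameter [d]. *)
Definition broom_sum (q n d : nat) : nat :=
  \sum_(j < d.+1) maxn j (d - j) ^ q + (n - d.+1) * d ^ q.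

(** Raising [d] by one turns one off-spine vertex into a spine vertex. Under this matching no term
    decreases, and the term of the first spine vertex grows strictly. *)
Lemma broom_sum_ltS q n d : 0 < q -> d.+1 < n ->
  broom_sum q n d < broom_sum q n d.+1.
Proof.
move=> q0 lt_n; rewrite /broom_sum.
have -> : n - d.+1 = (n - d.+2).+1 by lia.
rewrite mulSn addnA -addSn leq_add ?leq_mul ?leq_exp2r //.
rewrite big_ord_recl [in leqRHS]big_ord_recl [in leqRHS]big_ord_recr /=.
rewrite -addnA -addSn leq_add //; first by rewrite !max0n !subn0 ltn_exp2r.
rewrite leq_add ?leq_sum // => [j _|]; rewrite leq_exp2r // /bump /=; lia.
Qed.

Lemma broom_sum_leq q n d d' : 0 < q -> d <= d' < n ->
  broom_sum q n d <= broom_sum q n d'.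
Proof.
move=> q0 /andP[/subnKC <-]; elim: (d' - d) => [|m IHm] lt_n.
  by rewrite addn0.
apply: leq_trans (IHm _) _; first by lia.
by rewrite addnS ltnW // broom_sum_ltS // -addnS.
Qed.

(** * Power sums of the bounds attached to a path *)

Section EndDistance.
Variable T : finType.
Implicit Types (p : seq T) (x : T).

(** Used twice: as an upper bound on [ecc] when [p] is a longest path, and as its exact value when
    [p] is the spine of a caterpillar. *)
Definition end_dist p x : nat :=
  if x \in p then maxn (index x p) ((size p).-1 - index x p) else (size p).-1.

Lemma sum_end_dist q p : uniq p -> 0 < size p ->
  \sum_x end_dist p x ^ q = broom_sum q #|T| (size p).-1.
Proof.
case: p => [//|x0 p]; set s := x0 :: p => Us _; rewrite (bigID (mem s)) /=.
congr (_ + _).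
  rewrite -(@big_uniq _ _ _ _ s) // (big_nth x0) big_mkord.
  apply: eq_bigr => j _.
  by rewrite /end_dist mem_nth ?index_uniq.
rewrite (eq_bigr (fun=> size p ^ q)) => [|x /negbTE x_s]; last first.
  by rewrite /end_dist x_s.
rewrite sum_nat_const; congr (_ * _).
have <- : #|s| = (size p).+1 by apply/card_uniqP.
by rewrite -(cardC (mem s)) addKn; apply: eq_card => x; rewrite !inE.
Qed.
End EndDistance.

(** * Eccentricities along a longest path *)

Section LongestPath.
Variables (T : finType) (e : rel T).
Hypotheses (e_sym : symmetric e) (e_conn : connected_graph e).
Implicit Types (p : seq T).

Definition longest_path p : Prop :=
  [/\ sorted e p, uniq p
    & forall p', sorted e p' -> uniq p' -> size p' <= size p].

Lemma longest_path_exists : exists2 p, longest_path p & 0 < size p.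
Proof.
have [/card_gt0P[x0 _] _] := e_conn.
pose P m := [exists p : m.-tuple T, sorted e p && uniq p].
have P1 : exists m, P m by exists 1; apply/existsP; exists [tuple x0].
have Pbound m : P m -> m <= #|T|.
  case/existsP=> p /andP[_ Up]; rewrite -(size_tuple p) -(card_uniqP Up).
  exact: max_card.
case: (ex_maxnP P1 Pbound) => m /existsP[p /andP[ep Up]] max_m.
have longest p' : sorted e p' -> uniq p' -> size p' <= size p.
  rewrite size_tuple => ep' Up'; apply: max_m; apply/existsP.
  by exists (in_tuple p'); rewrite ep'.
by exists p; [split | apply: (longest [:: x0])].
Qed.

Lemma sorted_rev p : sorted e (rev p) = sorted e p.
Proof. by rewrite rev_sorted; case: p => //= x p; apply: eq_path => y z; apply: e_sym. Qed.

Lemma longest_path_rev p : longest_path p -> longest_path (rev p).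
Proof. by case=> ep Up max_p; split; rewrite ?sorted_rev ?rev_uniq ?size_rev. Qed.

(** Start with a simple path from a vertex of [p] to [u]. Whenever its tail meets [p] again, restart
    at that meeting point; the tail gets shorter each time. *)
Lemma path_leaving p u : p != [::] -> exists x q,
  [/\ x \in p, path e x q, last x q = u, uniq (x :: q) & ~~ has (mem p) q].
Proof.
move=> p_neq0; have [x0 px0] : exists x0, x0 \in p.
  by case: p p_neq0 => // x0 p _; exists x0; rewrite mem_head.
have [_ /(_ x0 u) /dist_uniq_path[q [eq_ <- Uq _]]] := e_conn.
have [n le_n] := ubnP (size q).
elim: n x0 q eq_ Uq le_n px0 => // n IHn x q eq_ Uq le_n px.
have [/hasP[y qy py]|Nq] := boolP (has (mem p) q); last by exists x, q.
case/splitPr: q / qy eq_ Uq le_n => q1 q2 eq_ Uq le_n.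
rewrite last_cat /=; apply: IHn => //.
- by move: eq_; rewrite cat_path => /and3P[].
- by move: Uq; rewrite -cat_cons cat_uniq => /and3P[].
by move: le_n; rewrite size_cat /=; lia.
Qed.

(* Otherwise replacing [p2] by [q] would give a longer path. *)
Lemma longest_path_detour p1 x p2 q :
  longest_path (p1 ++ x :: p2) -> path e x q -> uniq (x :: q) ->
  ~~ has (mem (p1 ++ x :: p2)) q -> size q <= size p2.
Proof.
case=> ep Up max_p eq_ Uq Nq.
have := max_p (p1 ++ x :: q); rewrite !size_cat leq_add2l /= ltnS; apply.
  move: ep; rewrite !sorted_cat_cons => /andP[-> _].
  exact: eq_.
move: Up; rewrite !cat_uniq => /and3P[-> Np _]; rewrite Uq andbT /=.
move: Np; rewrite /= !negb_or => /andP[-> _] /=.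
by apply: contra Nq => /hasP[y yq yp]; apply/hasP; exists y; rewrite //= mem_cat yp.
Qed.

Lemma longest_path_ecc p x : longest_path p -> ecc e x <= end_dist p x.
Proof.
move=> long_p; have [ep Up max_p] := long_p; have [/card_gt0P[x0 _] e_conn2] := e_conn.
have p_gt0 : 0 < size p by apply: (max_p [:: x0]).
apply/ecc_leP => u; rewrite /end_dist; case: ifP => [px|_]; last first.
  have [q [eq_ _ Uq le_q]] := dist_uniq_path (e_conn2 x u).
  by have := max_p (x :: q) eq_ Uq; rewrite /=; lia.
have [|y [q [py eq_ lq Uq Nq]]] := @path_leaving p u; first by rewrite -size_eq0 -lt0n.
have ltx : index x p < size p by rewrite index_mem.
have lty : index y p < size p by rewrite index_mem.
have := dist_nth e_sym x0 ep ltx lty; rewrite !nth_index // => le_xy.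
have := dist_triangle e y x u; have := dist_le_walk eq_; rewrite lq.
(* With i, m the indices of [x], [y] and r the size of [q], the route has length |i - m| + r. The
   first inequality bounds it by L - i when m >= i, the second by i when m <= i. *)
have : index y p + size q < size p /\ size q <= index y p; last by lia.
move: long_p Nq; case/splitPr: py Up {ep max_p p_gt0 px ltx lty le_xy} => p1 p2.
rewrite cat_uniq /= negb_or => /and3P[_ /andP[Np _] _] long_p Nq.
rewrite size_cat /= index_cat (negbTE Np) /= eqxx addn0.
have le2 := longest_path_detour long_p eq_ Uq Nq.
split; first by lia.
(* The second inequality is the first one read on the reversed path. *)
move/longest_path_rev: long_p; rewrite rev_cat rev_cons -cats1 -catA cat1s.
move/longest_path_detour => /(_ q eq_ Uq); rewrite size_rev; apply.
apply: contra Nq; apply: sub_has => z.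
by rewrite /= !mem_cat !inE !mem_rev orbC orbA (orbC (z \in p1)) -!orbA.
Qed.

Lemma sum_ecc_longest q p : longest_path p -> 0 < size p -> 0 < q ->
  \sum_x ecc e x ^ q <= broom_sum q #|T| (size p).-1.
Proof.
move=> long_p p0 q0; have [_ Up _] := long_p; rewrite -sum_end_dist //.
by apply: leq_sum => x _; rewrite leq_exp2r // longest_path_ecc.
Qed.

Lemma mem_spanning_seq p x : uniq p -> #|T| <= size p -> x \in p.
Proof.
move=> Up le_p.
have [||_ ->] := @uniq_min_size _ p (enum T) Up; rewrite ?mem_enum -?cardE //.
by move=> y _; rewrite mem_enum.
Qed.

(** The index along [p] is the isomorphism. Since [p] spans the graph and starts at distance at
    least n - 1 from [v], no edge can be a shortcut between non-consecutive vertices of [p]. *)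
Lemma spanning_geodesic_isomorphic n x0 p v : #|T| = n -> simple_graph e ->
  sorted e p -> uniq p -> size p = n ->
  n.-1 <= dist e (nth x0 p 0) v -> isomorphic e (@path_rel n).
Proof.
move=> cardT [_ e_irr] ep Up szp le_d.
have p_all x : x \in p by rewrite mem_spanning_seq // cardT szp.
have lt_index x : index x p < n by rewrite -szp index_mem.
have dist_index x y : dist e x y <= index x p - index y p + (index y p - index x p).
  have := dist_nth e_sym x0 ep (i := index x p) (j := index y p).
  by rewrite !nth_index // !index_mem; apply.
pose f x := Ordinal (lt_index x).
have f_inj : injective f.
  by move=> x y [eq_xy]; rewrite -(nth_index x (p_all x)) eq_xy nth_index.
have n0 : 0 < n by apply: leq_ltn_trans (lt_index v).
have index0 : index (nth x0 p 0) p = 0 by rewrite index_uniq ?szp.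
(* The distance bound forces [v] to be last in [p]. An edge skipping forward over a vertex would
   then lead from the start to [v] in fewer than n - 1 steps. *)
have edge_index x y : e x y -> index y p <= (index x p).+1.
  move=> exy; have := dist_triangle e x (nth x0 p 0) v.
  have := dist_triangle e y x v; have := dist_edge exy.
  have := dist_index (nth x0 p 0) x; have := dist_index y v.
  have := dist_index (nth x0 p 0) v.
  have := lt_index v; have := lt_index y; rewrite index0; lia.
have index_edge x y : (index x p).+1 = index y p -> e x y.
  move=> eq_xy; rewrite -(nth_index x0 (p_all x)) -(nth_index x0 (p_all y)) -eq_xy.
  by apply: (sortedP x0 ep); rewrite eq_xy szp.
exists f; split=> [|x y].
  by apply: inj_card_bij; rewrite // card_ord cardT.
rewrite /path_rel /=; apply/orP/idP => [[/eqP/index_edge //|/eqP/index_edge]|exy].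
  by rewrite e_sym.
have xy : index x p != index y p.
  apply/eqP => eq_xy; move: exy; rewrite -(nth_index x (p_all x)) eq_xy.
  by rewrite nth_index // e_irr.
have := edge_index _ _ exy; have := edge_index y x; rewrite e_sym => /(_ exy).
by lia.
Qed.

(** Strict growth of [broom_sum] makes [p] spanning. The terms are then bounded one by one by
    [end_dist], so a deficit at the first vertex of [p] would make the sum too small. *)
Lemma longest_path_attains q p : longest_path p -> 0 < size p -> 0 < q ->
  simple_graph e ->
  broom_sum q #|T| (#|T|).-1 <= \sum_x ecc e x ^ q -> isomorphic e (@path_rel #|T|).
Proof.
move=> long_p p0 q0 simple_e le_sum; have [ep Up max_p] := long_p.
have le_p : size p <= #|T| by rewrite -(card_uniqP Up) max_card.
have := leq_trans le_sum (sum_ecc_longest long_p p0 q0).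
case: (ltnP (size p) #|T|) => [lt_p|ge_p].
  have ltn_sum : broom_sum q #|T| (size p).-1 < broom_sum q #|T| (#|T|).-1.
    apply: leq_trans (broom_sum_ltS _ _) (broom_sum_leq _ _) => //; lia.
  by rewrite leqNgt ltn_sum.
have szp : size p = #|T| by apply/eqP; rewrite eqn_leq le_p.
case: p => [//|x0 p] in long_p p0 ep Up max_p le_p ge_p szp * => _.
have [v eq_ecc] := ecc_attained e x0.
apply: (spanning_geodesic_isomorphic (x0 := x0) (p := x0 :: p) (v := v)) => //=.
rewrite -eq_ecc leqNgt; apply/negP => lt_ecc.
move: le_sum; rewrite -[X in X.-1]szp -(sum_end_dist q Up) // leqNgt => /negP; apply.
rewrite (bigD1 x0) //= [ltnRHS](bigD1 x0) //= -addSn leq_add //.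
  by rewrite ltn_exp2r // (leq_trans lt_ecc) // -szp /end_dist mem_head /= eqxx max0n subn0.
by apply: leq_sum => x _; rewrite leq_exp2r // longest_path_ecc.
Qed.

End LongestPath.

(** * Matchings inside a path *)

Section Matching.
Variables (T : finType) (e : rel T).

(** Take every other edge of the path. The last clause strengthens the induction: it keeps the edges
    already chosen away from the two vertices put in front. *)
Lemma path_matching (p : seq T) : sorted e p -> uniq p ->
  exists M : {set T * T}, [/\ is_matching e M, #|M| = (size p)./2 &
    forall z, z \in M -> (z.1 \in p) && (z.2 \in p)].
Proof.
have [n] := ubnP (size p); elim: n p => // n IHn [|x [|y p]] /= le_n ep Up.
- exists set0; rewrite cards0; split=> // [|z]; last by rewrite inE.
  by apply/andP; split; apply/forall_inP => z; rewrite inE.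
- exists set0; rewrite cards0; split=> // [|z]; last by rewrite inE.
  by apply/andP; split; apply/forall_inP => z; rewrite inE.
case/andP: ep => exy /path_sorted ep; move: Up => /and3P[].
rewrite inE negb_or => /andP[xy xp] yp Up.
have [|M [/andP[eM disjM] cardM Mp]] := IHn p _ ep Up; first by lia.
have disj_xy z : z \in M -> [disjoint [set x; y] & [set z.1; z.2]].
  move/Mp => /andP[z1 z2]; rewrite disjoints_subset subUset !sub1set !inE !negb_or.
  by rewrite !(memPnC _ _ z1, memPnC _ _ z2) ?(memPn xp, memPn yp) // eq_sym.
have xyM : (x, y) \notin M by apply: contra xp => /Mp /andP[].
exists ((x, y) |: M); split.
- apply/andP; split; apply/forall_inP => z; rewrite in_setU1.
    by case/predU1P=> [->|/(forall_inP eM)].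
  case/predU1P=> [->|zM]; apply/forall_inP => z'; rewrite in_setU1.
    by case/predU1P=> [->|/disj_xy-> /[!implybT]]; rewrite ?eqxx.
  case/predU1P=> [->|]; first by rewrite disjoint_sym disj_xy // implybT.
  by move=> z'M; apply: (forall_inP (forall_inP disjM z zM)).
- by rewrite cardsU1 xyM cardM.
move=> z; rewrite in_setU1 => /predU1P[->|/Mp /andP[z1 z2]] /=.
  by rewrite !inE !eqxx orbT.
by rewrite !inE z1 z2 !orbT.
Qed.

Lemma half_size_path_matching (p : seq T) : sorted e p -> uniq p ->
  (size p)./2 <= matching_number e.
Proof.
move=> ep Up; have [M [matchM <- _]] := path_matching ep Up.
exact: (@leq_bigmax_cond _ _ (fun M : {set T * T} => #|M|)).
Qed.
End Matching.

(* Covers both paths and double-brooms: [pos] unfolds the graph onto [0, d], and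
   every vertex outside the spine [p] is a twin of an end of [p]. *)
Section Caterpillar.
Variables (T : finType) (e : rel T) (x0 : T) (p : seq T) (pos : T -> nat).
Let d := (size p).-1.
Hypotheses (e_sym : symmetric e) (ep : sorted e p) (Up : uniq p) (p_gt0 : 0 < size p).
Hypothesis pos_index : forall x, x \in p -> pos x = index x p.
Hypothesis pos_edge : forall x y, e x y -> pos y <= (pos x).+1.
Hypothesis pos_leaf : forall x, x \notin p -> 1 < d /\
  (pos x = 0 /\ e x (nth x0 p 1) \/ pos x = d /\ e x (nth x0 p d.-1)).

(** The upper bound routes through spine vertices near [x] and [y]. The lower bound applies
    [dist_lipschitz] with [pos] to both ends of the spine. *)
Lemma caterpillar_ecc x : ecc e x = end_dist p x.
Proof.
have szp : size p = d.+1 by rewrite prednK.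
(* A spine vertex anchors itself; a twin of an end is anchored at that end's neighbor, one step
   away. Two twins of the same end may be at distance 2, which [1 < d] accommodates. *)
have anchor y : exists c l, [/\ c < size p, dist e y (nth x0 p c) <= l &
    c = pos y /\ l = 0 \/
    1 < d /\ l = 1 /\ (pos y = 0 /\ c = 1 \/ pos y = d /\ c = d.-1)].
  have [py|Np] := boolP (y \in p).
    exists (index y p), 0; rewrite nth_index // dist_refl index_mem; split=> //.
    by left; rewrite pos_index.
  have [d2 [[pos0 ey]|[posd ey]]] := pos_leaf Np; [exists 1, 1|exists d.-1, 1];
    split; rewrite ?dist_edge // ?szp; try lia; right; auto.
have pos_le y : pos y <= d.
  have [c [l [ltc _ Hc]]] := anchor y.
  by lia.
have -> : end_dist p x = maxn (pos x) (d - pos x).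
  rewrite /end_dist; case: ifPn => [px|Np]; first by rewrite pos_index.
  by have [_ [[-> _]|[-> _]]] := pos_leaf Np; rewrite -/d; lia.
apply/eqP; rewrite eqn_leq; apply/andP; split.
  apply/ecc_leP => y; have [c [l [ltc le_x Hx]]] := anchor x.
  have [c' [l' [ltc' le_y Hy]]] := anchor y.
  have := dist_triangle e (nth x0 p c) x y.
  have := dist_triangle e (nth x0 p c') (nth x0 p c) y.
  have := dist_nth e_sym x0 ep ltc ltc'.
  rewrite (dist_sym e_sym y) in le_y.
  by lia.
have le_card : d < #|T|.
  by rewrite -szp -(card_uniqP Up) max_card.
have pos_nth j : j < size p -> pos (nth x0 p j) = j.
  by move=> ltj; rewrite pos_index ?mem_nth // index_uniq.
have lt_d : d < size p by rewrite szp.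
have := pos_le x; rewrite geq_max => le_pos; apply/andP; split.
  apply: leq_trans (dist_ecc e x (nth x0 p 0)); rewrite dist_sym //.
  have := @dist_lipschitz _ e pos (nth x0 p 0) x pos_edge.
  by rewrite pos_nth // subn0; apply; lia.
apply: leq_trans (dist_ecc e x (nth x0 p d)).
have := @dist_lipschitz _ e pos x (nth x0 p d) pos_edge.
by rewrite pos_nth //; apply; lia.
Qed.

Lemma caterpillar_diam : diam e = d.
Proof.
apply/eqP; rewrite eqn_leq; apply/andP; split.
  apply/bigmax_leqP => x _; rewrite caterpillar_ecc /end_dist -/d.
  by case: ifP => [px|//]; rewrite geq_max leq_subr -ltnS prednK // index_mem px.
apply: leq_trans (ecc_diam e (nth x0 p 0)).
by rewrite caterpillar_ecc /end_dist mem_nth // index_uniq // max0n subn0.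
Qed.

Lemma sum_ecc_caterpillar q : \sum_x ecc e x ^ q = broom_sum q #|T| d.
Proof.
rewrite -sum_end_dist //; apply: eq_bigr => x _.
by rewrite caterpillar_ecc.
Qed.
End Caterpillar.

(** * Paths and double-brooms as caterpillars *)

Lemma sum_ecc_path (T : finType) (e : rel T) q n : 0 < n -> isomorphic e (@path_rel n) ->
  \sum_x ecc e x ^ q = broom_sum q n n.-1.
Proof.
move=> n0 [f [[g fK gK] f_edge]].
have cardT : #|T| = n by rewrite -[n]card_ord (bij_eq_card (f := f)) //; exists g.
have [/card_gt0P[x0 _]] : 0 < #|T| by rewrite cardT.
pose p := map g (enum 'I_n).
have szp : size p = n by rewrite size_map size_enum_ord.
have nth_p j (lt_j : j < n) : nth x0 p j = g (Ordinal lt_j).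
  rewrite (nth_map (Ordinal lt_j)) ?size_enum_ord //; congr (g _).
  by apply: val_inj; rewrite /= nth_enum_ord.
have p_all x : x \in p by rewrite -[x]fK map_f // mem_enum.
have Up : uniq p by rewrite (map_inj_uniq (can_inj gK)) enum_uniq.
have index_p x : index x p = f x.
  by rewrite -{1}[x]fK /p index_map ?index_enum_ord //; apply: can_inj gK.
have edgeE x y : e x y = ((f x).+1 == f y :> nat) || ((f y).+1 == f x :> nat).
  by rewrite -f_edge.
rewrite (sum_ecc_caterpillar (x0 := x0) (p := p) (pos := f)) ?cardT ?szp //.
- by move=> x y; rewrite !edgeE orbC.
- apply/(sortedP x0) => j; rewrite szp => lt_j.
  by rewrite (nth_p _ lt_j) (nth_p _ (ltnW lt_j)) edgeE !gK /= eqxx.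
- by move=> x y; rewrite edgeE => /orP[] /eqP; lia.
by move=> x; rewrite p_all.
Qed.

Section DoubleBroom.
Variable T : finType.
Implicit Types (x y : T) (s : seq T).

(** Membership of [x] is implied: [y] in [s] puts [index x s] below [size s]. *)
Lemma mem_zip_behead s x y : uniq s ->
  ((x, y) \in zip s (behead s)) = (y \in s) && (index y s == (index x s).+1).
Proof.
case: s => // a s; elim: s a => [|b s IHs] a Us.
  by rewrite /= !inE; case: (y =P a) => //= ->; rewrite eqxx.
move: Us; rewrite cons_uniq => /andP[Na Us]; have {IHs} := IHs b Us.
rewrite -[zip (a :: _) _]/((a, b) :: zip (b :: s) (behead (b :: s))).
rewrite [_ \in (a, b) :: _]in_cons xpair_eqE => ->.
rewrite [y \in a :: _]inE [index y (a :: _)]/= [index x (a :: _)]/=.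
rewrite [a == y]eq_sym [a == x]eq_sym; have [->|_] := eqVneq y a.
  rewrite (negbTE Na) /=; case: eqVneq => [_|//] /=.
  by move: Na; rewrite inE negb_or => /andP[/negbTE->].
case: eqVneq => [->|_] //=; rewrite eqSS [b == y]eq_sym [b == a]eq_sym.
move: Na; rewrite inE negb_or => /andP[/negbTE-> Na]; rewrite (memNindex Na) inE.
have [//|_ /=] := eqVneq y b; case ys: (y \in s) => //=.
by rewrite -index_mem in ys; rewrite eqSS; apply/negbTE; rewrite neq_ltn ltnS ltnW.
Qed.

(** The given spine [s] may stop short of a diametral path. Extending it by one leaf at each end
    that has any gives a caterpillar spine [p]; the remaining leaves are twins of the added ones. *)
Lemma double_broom_sum_ecc (e : rel T) q : symmetric e -> double_broom e -> 2 < diam e ->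
  \sum_x ecc e x ^ q = broom_sum q #|T| (diam e).
Proof.
move=> e_sym [s [side [s_neq0 Us eE]]] diam2.
have [a [s' def_s]] : exists a s', s = a :: s' by case: s s_neq0 {Us eE} => // a s' _; exists a, s'.
have head_s y : head y s = a by rewrite def_s.
have last_s y : last y s = last a s' by rewrite def_s.
have consecE x y : consec s x y = [&& x \in s, y \in s
    & ((index x s).+1 == index y s) || ((index y s).+1 == index x s)].
  rewrite /consec !mem_zip_behead // ![index _ s == _]eq_sym.
  have [xs|xs] := boolP (x \in s); have [ys|ys] := boolP (y \in s) => //=.
    by rewrite (memNindex ys) [_ == index x s]eqn_leq ltnNge index_size.
  by rewrite (memNindex xs) orbF [_ == index y s]eqn_leq ltnNge index_size.
have leafE x y : x \notin s -> e x y = (y == if side x then a else last a s').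
  move=> xs; rewrite eE consecE (negbTE xs) /= head_s last_s; case: eqVneq => //= y_end.
  apply/negP => /andP[ys /eqP x_end]; case/negP: xs; rewrite x_end head_s last_s.
  by case: ifP => _; rewrite def_s ?mem_head ?mem_last.
have spineE x y : x \in s -> y \in s -> e x y =
    ((index x s).+1 == index y s) || ((index y s).+1 == index x s).
  by move=> xs ys; rewrite eE consecE xs ys /= orbF.
have szs : size s = (size s').+1 by rewrite def_s.
have as_ : a \in s by rewrite def_s mem_head.
have zs : last a s' \in s by rewrite def_s mem_last.
have index_a : index a s = 0 by rewrite def_s /= eqxx.
have index_z : index (last a s') s = size s' by rewrite def_s index_last // -def_s.
pose leaf b := seq_of_opt [pick x | (x \notin s) && (side x == b)].
have leafP b : leaf b = [::] \/ exists x, [/\ leaf b = [:: x], x \notin s & side x = b].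
  rewrite /leaf; case: pickP => [x /andP[xs /eqP side_x]|_]; last by left.
  by right; exists x.
have leafT x : x \notin s -> size (leaf (side x)) = 1.
  by move=> xs; rewrite /leaf; case: pickP => // /(_ x); rewrite xs eqxx.
pose L := size (leaf true).
pose p := leaf true ++ s ++ leaf false.
(* All leaves of one end share one position, whether or not they were chosen for [p]. *)
pose pos x := if x \in s then L + index x s else if side x then 0 else L + size s.
have szp : size p = L + size s + size (leaf false) by rewrite !size_cat addnA.
have Up : uniq p.
  rewrite /p; case: (leafP true) => [->|[y [-> ys side_y]]];
    case: (leafP false) => [->|[z [-> zNs side_z]]];
    rewrite /= ?cats0 ?cats1 ?mem_rcons ?inE ?rcons_uniq ?negb_or ?ys ?zNs ?Us ?andbT //.
  by apply: contraTneq side_y => ->; rewrite side_z.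
have pos_index x : x \in p -> pos x = index x p.
  have leaf_mem b : x \in leaf b -> [/\ leaf b = [:: x], x \notin s & side x = b].
    by case: (leafP b) => [->|[z [-> zNs side_z]]]; rewrite // inE => /eqP->.
  rewrite /pos /p /L !index_cat !mem_cat; case: ifPn => [xs _|xs].
    by case: ifP => [lx|//]; case: (leaf_mem true lx) => _ /negP[].
  case: (boolP (x \in leaf true)) => [lx _|_ lx].
    by case: (leaf_mem true lx) => -> _ ->; rewrite /= eqxx.
  by case: (leaf_mem false lx) => -> _ ->; rewrite /= eqxx addn0.
have es : path e a s'.
  rewrite -[path e a s']/(sorted e (a :: s')) -def_s; apply/(sortedP a) => j lt_j.
  by rewrite spineE ?mem_nth ?index_uniq ?eqxx // ltnW.
have ep : sorted e p.
  rewrite /p def_s; case: (leafP true) => [->|[y [-> ys side_y]]];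
    case: (leafP false) => [->|[z [-> zNs side_z]]];
    rewrite /= ?cats0 ?cat_path ?es /= ?(leafE y) ?(e_sym _ z) ?(leafE z) ?side_y ?side_z ?eqxx //.
(* Stars are excluded by the diameter: their leaves may all be on one side, and [p] would then have
   only two vertices. *)
have s2 : 1 < size s.
  rewrite ltnNge; apply/negP => s1; have s'0 : s' = [::] by apply: size0nil; lia.
  have dist_a x : dist e x a <= 1.
    have [xs|xs] := boolP (x \in s); last first.
      by apply: dist_edge; rewrite leafE // s'0 /= if_same.
    by move: xs; rewrite def_s s'0 inE => /eqP->; rewrite dist_refl.
  move: diam2; rewrite ltnNge => /negP; apply.
  apply/bigmax_leqP => x _; apply/ecc_leP => y.
  apply: leq_trans (dist_triangle e a x y) _.
  by rewrite (dist_sym e_sym a); apply: (leq_add (dist_a x) (dist_a y)).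
have pos_a : pos a = L by rewrite /pos as_ index_a addn0.
have pos_z : pos (last a s') = L + size s' by rewrite /pos zs index_z.
have L1 : L <= 1 by rewrite /L; case: (leafP true) => [->|[y [->]]].
have pos_edge x y : e x y -> pos y <= (pos x).+1.
  have [xs|xs] := boolP (x \in s); have [ys|ys] := boolP (y \in s).
  - by rewrite spineE // /pos xs ys => /orP[] /eqP; lia.
  - rewrite e_sym leafE // {1}/pos (negbTE ys) => /eqP->.
    by case: ifP; rewrite ?pos_z ?szs //; lia.
  - rewrite leafE // {2}/pos (negbTE xs) => /eqP->.
    by case: ifP; rewrite ?pos_a ?pos_z //; lia.
  by rewrite leafE // => /eqP y_end; case/negP: ys; rewrite y_end; case: ifP.
(* A leaf outside [p] shows that its side did supply a leaf to [p]; both hang from the same end of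
   [s]. *)
have pos_leaf x : x \notin p -> 1 < (size p).-1 /\
  (pos x = 0 /\ e x (nth a p 1) \/ pos x = (size p).-1 /\ e x (nth a p (size p).-2)).
  rewrite !mem_cat !negb_or => /and3P[_ xs _]; have := leafT x xs.
  rewrite !leafE // szp /pos (negbTE xs) -/L; case: (side x) => leaf1.
    split; first by rewrite /L; lia.
    left; split=> //; rewrite /p nth_cat leaf1 /= subnn nth_cat.
    by rewrite (ltnW s2) def_s.
  split; first by lia.
  right; split; first by lia.
  have -> : (L + size s + size (leaf false)).-2 = L + size s' by lia.
  rewrite /p nth_cat -/L ltnNge leq_addr /= addKn nth_cat szs ltnSn.
  by rewrite -index_z nth_index.
have p0 : 0 < size p by rewrite szp; lia.
rewrite (caterpillar_diam (x0 := a) (p := p) (pos := pos)) //.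
exact: (sum_ecc_caterpillar (x0 := a) (p := p) (pos := pos)).
Qed.
End DoubleBroom.

(** * Closed forms for even diameter *)

(** From 2k to 2k + 2, every old term grows by one and two end terms 2k + 2 appear. The summand
    [k * k] is the floor of d^2/4 at d = 2k. *)
Lemma broom_sum1_even k :
  \sum_(j < (2 * k).+1) maxn j (2 * k - j) ^ 1 + k * k = (2 * k).+1 * (2 * k).
Proof.
elim: k => [|k IHk]; first by rewrite big_ord_recr big_ord0.
have -> : 2 * k.+1 = (2 * k).+2 by lia.
rewrite big_ord_recl big_ord_recr /=.
have -> : \sum_(j < (2 * k).+1) maxn (bump 0 j) ((2 * k).+2 - bump 0 j) ^ 1
  = \sum_(j < (2 * k).+1) maxn j (2 * k - j) ^ 1 + (2 * k).+1.
  rewrite -[X in _ + X]card_ord -sum1_card -big_split /=.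
  by apply: eq_bigr => j _; rewrite !expn1 /bump /=; have := ltn_ord j; lia.
by move: IHk; rewrite /bump /= !expn1; move: (\sum_(_ < _) _) => S; lia.
Qed.

(** The same shift; expanding (t + 1)^2 brings in the first power sum. The factor 3 clears the
    denominator. *)
Lemma broom_sum2_even k :
  3 * \sum_(j < (2 * k).+1) maxn j (2 * k - j) ^ 2 = 14 * k ^ 3 + 12 * k ^ 2 + k.
Proof.
elim: k => [|k IHk]; first by rewrite big_ord_recr big_ord0.
have sum1 := broom_sum1_even k.
have -> : 2 * k.+1 = (2 * k).+2 by lia.
rewrite big_ord_recl big_ord_recr /=.
have -> : \sum_(j < (2 * k).+1) maxn (bump 0 j) ((2 * k).+2 - bump 0 j) ^ 2
  = \sum_(j < (2 * k).+1) maxn j (2 * k - j) ^ 2 + (2 * k).+1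
  + 2 * \sum_(j < (2 * k).+1) maxn j (2 * k - j) ^ 1.
  rewrite -[X in _ + X + _]card_ord -sum1_card big_distrr -!big_split /=.
  apply: eq_bigr => j _; rewrite !expn1 /bump /=.
  have -> : maxn (1 + j) ((2 * k).+2 - (1 + j)) = (maxn j (2 * k - j)).+1.
    by have := ltn_ord j; lia.
  by lia.
move: IHk sum1; rewrite /bump /=; move: (\sum_(_ < _) _) (\sum_(_ < _) _) => S2 S1.
nia.
Qed.

(** Gives both invariants one shape, a power sum over a normalizing constant, so that a single
    argument serves both values of [i]. *)
Lemma sigmaE (i : 'I_2) (T : finType) (e : rel T) :
  sigma i e = ((\sum_x ecc e x ^ i.+1)%:R / (if val i == 0 then #|T| else 1)%:R)%R.
Proof.
rewrite /sigma; case: i => [[|[|//]] i2] /=; last by rewrite divr1.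
by rewrite /sigma0; congr (_%:R / _)%R; apply: eq_bigr => x _; rewrite expn1.
Qed.

Lemma f_even (i : 'I_2) n k : 2 * k < n ->
  f i n (2 * k) = ((broom_sum i.+1 n (2 * k))%:R / (if val i == 0 then n else 1)%:R)%R.
Proof.
move=> lt_n; have n0 : (n%:R != 0 :> rat)%R by rewrite pnatr_eq0; lia.
rewrite /f /broom_sum; case: i => [[|[|//]] i2] /=.
  rewrite /f0; have -> : (2 * k) ^ 2 %/ 4 = k * k by rewrite expnMn mulKn // -mulnn.
  (* Multiplying by [n] leaves an identity of natural numbers. *)
  apply: (mulIf n0); rewrite mulfVK // mulrBl mulfVK // -natrM.
  apply/eqP; rewrite subr_eq -natrD eqr_nat; apply/eqP.
  have := broom_sum1_even k; move: (\sum_(_ < _) _) => S; rewrite expn1; nia.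
(* [n] is split into the 2k + 1 spine vertices and a remainder [r], which removes the truncated
   subtraction of [broom_sum]. *)
rewrite /f1 /eps oddM /= divr1 -{1}(subnKC lt_n).
have := congr1 (fun m => m%:R : rat)%R (broom_sum2_even k).
move: (\sum_(_ < _) _) (n - _) => S r.
rewrite !(natrD, natrM, natrX, =^~ natr1) => S_eq.
have {S_eq}-> : (S%:R = (14 * k%:R ^+ 3 + 12 * k%:R ^+ 2 + k%:R) / 3 :> rat)%R.
  by rewrite -S_eq; field.
by field.
Qed.

Theorem theorem5p4 (i : 'I_2) (T : finType) (e : rel T) (n k : nat) :
  simple_graph e -> connected_graph e -> #|T| = n -> matching_number e = k ->
  ((2 <= k < n./2)%N ->
     (sigma i e <= f i n (2 * k))%R /\
     (forall (T' : finType) (e' : rel T'),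
        simple_graph e' -> #|T'| = n -> double_broom e' -> diam e' = (2 * k)%N ->
        sigma i e' = f i n (2 * k))) /\
  (k = n./2 ->
     (sigma i e <= sigma i (@path_rel n))%R /\
     (sigma i e = sigma i (@path_rel n) <-> isomorphic e (@path_rel n))).
Proof.
move=> simple_e e_conn cardT matchk; have [e_sym _] := simple_e.
have n0 : 0 < n by rewrite -cardT; case: e_conn.
have c0 : (0 < (if val i == 0 then n else 1)%:R^-1 :> rat)%R.
  by rewrite invr_gt0 ltr0n; case: ifP.
have [p long_p p0] := longest_path_exists e_conn; have [ep Up _] := long_p.
have le_p : size p <= n by rewrite -cardT -(card_uniqP Up) max_card.
have le_sum := sum_ecc_longest e_sym e_conn long_p p0 (ltn0Sn i).
split=> [/andP[k2 ltk]|_].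
  have lt_2k : 2 * k < n by lia.
  (* The path carries a matching of [(size p)./2] edges, so [size p] is at most 2k + 1. *)
  have p_2k : (size p).-1 <= 2 * k.
    by have := half_size_path_matching ep Up; rewrite matchk; lia.
  split=> [|T' e' [e'_sym _] cardT' broom_e' diam_e'].
    rewrite f_even // sigmaE cardT ler_pM2r // ler_nat.
    by apply: leq_trans le_sum _; rewrite cardT broom_sum_leq // p_2k.
  (* Since [2 <= k], the diameter is at least 4, as [double_broom_sum_ecc] requires more than 2. *)
  rewrite f_even // sigmaE cardT' (double_broom_sum_ecc _ e'_sym broom_e').
    by rewrite diam_e' cardT'.
  by rewrite diam_e'; lia.
have path_iso : isomorphic (@path_rel n) (@path_rel n).
  by exists id; split=> //; exists id.
rewrite !sigmaE cardT card_ord ler_pM2r // (sum_ecc_path _ n0 path_iso) ler_nat.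
split; first by apply: leq_trans le_sum _; rewrite cardT broom_sum_leq //; lia.
split=> [|iso_e]; last by rewrite (sum_ecc_path _ n0 iso_e).
(* The positive normalizing factor cancels, leaving equal power sums, the extremal case of
   [longest_path_attains]. *)
move/(mulIf (lt0r_neq0 c0))/eqP; rewrite eqr_nat => /eqP sum_eq.
move: (longest_path_attains e_sym e_conn long_p p0 (ltn0Sn i) simple_e).
by rewrite cardT sum_eq; apply.
Qed.
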